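(* Let $0<\theta<\pi$, let $P_\theta=\big(\frac{\theta+\sin\theta}{2},\cos^2\frac\theta2\big)$ (a point of $\Gamma_\theta$), and let $T_\theta$ be the tangent line to the curve $\Gamma_\theta$ at $P_\theta$. Then (1) $\inf_{P\in T_\theta\cap\mathcal{H}}d_H((0,1),P)=\theta$; and (2) $T_\theta$ is the line $x=\frac\theta2+v\tan\frac\theta2$, i.e. $T_\theta\cap\mathcal{H}=L_{\beta,\gamma}$ with $\beta=\frac\theta2$, $\gamma=\tan\frac\theta2$.
   Context: Let $\mathcal{H}=\{(x,v)\in\mathbb{R}^2:v\ge0\}$ and $d_H$ the Riemannian distance on $\mathcal{H}$ induced by $ds^2=v^{-1}(dx^2+dv^2)$ on the open upper half-plane (extended to the boundary). For $v\ge0$, $0<|\delta|<2\pi$, set $f(v,\delta)=\frac{(v+1)(\delta-\sin\delta)+2\sqrt v(2\sin\frac\delta2-\delta\cos\frac\delta2)}{2\sin^2\frac\delta2}$ and $f(v,0)=0$; $\delta(x,v)$ is the unique $\delta\in(-2\pi,2\pi)$ with $f(v,\delta)=x$, and $\Gamma_\theta=\{(x,v)\in\mathcal{H}:\delta(x,v)=\theta\}$. For $0<\theta<2\pi$, $\Gamma_\theta$ is the graph of a smooth function of $x$ on $[\frac{\theta-\sin\theta}{1-\cos\theta},\infty)$. $L_{\beta,\gamma}=\{(x,v)\in\mathcal{H}:x=\beta+\gamma v\}$. *)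

(* Defs.v *)
From HB Require Import structures.
From mathcomp Require Import all_boot all_order all_algebra.
From mathcomp Require Import all_classical all_reals all_analysis.
Set Implicit Arguments. Unset Strict Implicit. Unset Printing Implicit Defensive.
Import Order.TTheory GRing.Theory Num.Theory.
Import numFieldNormedType.Exports.
Local Open Scope classical_set_scope.
Local Open Scope ring_scope.

Section Defs.
Variable R : realType.

Definition Hplane : set (R * R) := [set p | 0 <= p.2].

Definition admissible_curve (c : R -> R * R) (p q : R * R) : Prop :=
  (forall t, derivable (fun s => (c s).1) t 1) /\
  (forall t, derivable (fun s => (c s).2) t 1) /\
  continuous (derive1 (fun s => (c s).1)) /\
  continuous (derive1 (fun s => (c s).2)) /\
  (forall t, 0 <= t <= 1 -> 0 <= (c t).2) /\
  c 0 = p /\ c 1 = q.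

(* the length element of ds^2 = v^{-1}(dx^2+dv^2); on the boundary v = 0 the
   speed is infinite unless the curve is at rest *)
Definition speedH (c : R -> R * R) (t : R) : \bar R :=
  let sq := (derive1 (fun s => (c s).1) t) ^+ 2 + (derive1 (fun s => (c s).2) t) ^+ 2 in
  if 0 < (c t).2 then (Num.sqrt (sq / (c t).2))%:E
  else if sq == 0 then 0%E else +oo%E.

Definition lengthH (c : R -> R * R) : \bar R :=
  (\int[lebesgue_measure]_(t in `[0%R, 1%R]) speedH c t)%E.

Definition dH (p q : R * R) : \bar R :=
  ereal_inf [set lengthH c | c in [set c | admissible_curve c p q]].

Definition fH (v d : R) : R :=
  if d == 0 then 0 else
  ((v + 1) * (d - sin d) + 2 * Num.sqrt v * (2 * sin (d / 2) - d * cos (d / 2)))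
  / (2 * (sin (d / 2)) ^+ 2).

(* delta(x,v): the unique d in (-2pi, 2pi) with f(v,d) = x *)
Definition deltaH (x v : R) : R :=
  xget 0 [set d | - (2 * pi) < d < 2 * pi /\ fH v d = x].

Definition Gamma (th : R) : set (R * R) :=
  [set p | 0 <= p.2 /\ deltaH p.1 p.2 = th].

(* for 0 < th < 2pi, Gamma th is the graph of a function of x; gGamma th is that function *)
Definition gGamma (th : R) (x : R) : R :=
  xget 0 [set v | (x, v) \in Gamma th].

Definition Ptheta (th : R) : R * R :=
  ((th + sin th) / 2, (cos (th / 2)) ^+ 2).

Definition Ttheta (th : R) : set (R * R) :=
  let x0 := (Ptheta th).1 in
  [set p | p.2 = gGamma th x0 + derive1 (gGamma th) x0 * (p.1 - x0)].

Definition Lline (beta gamma : R) : set (R * R) :=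
  [set p | 0 <= p.2 /\ p.1 = beta + gamma * p.2].

End Defs.

(* Main.v *)
Require Import Defs.
From HB Require Import structures.
From mathcomp Require Import all_boot all_order all_algebra.
From mathcomp Require Import all_classical all_reals all_analysis.
From mathcomp Require Import ring lra.
Import Order.TTheory GRing.Theory Num.Theory.
Import numFieldNormedType.Exports.
Local Open Scope classical_set_scope.
Local Open Scope ring_scope.

(* Tangent line: writing w = sqrt v, f(w^2, theta) is a quadratic polynomial
   A w^2 + 2 B w + A in w with A, B > 0 increasing in theta; this gives the
   uniqueness of delta and an explicit formula for the graph of Gamma_theta.

   Upper bound: t |-> ((theta t + sin (theta t)) / 2, (1 + cos (theta t)) / 2)
   is a cycloid of constant speed theta from (0, 1) to P_theta.

   Lower bound: the lines T_theta are the level sets of a calibration U with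
   U(0, 1) = 0 and v |grad U|^2 = 4 q / (1 + q)^2 <= 1, where
   q = v / cos^2 (theta / 2).  Instead of differentiating the implicit function
   U, we follow along a curve (x, v) with arc length G the quantity
   G / 2 + v tan (G / 2) - x, which starts at 0 and is nondecreasing. *)

(** * Monotonicity from the sign of a derivative *)

Lemma is_derive_continuous (R : realType) (f : R -> R) (x d : R) :
  is_derive x 1 f d -> {for x, continuous f}.
Proof.
by case=> df _; exact/differentiable_continuous/derivable1_diffP.
Qed.

(** Positivity is asked only in the open interval because the trigonometric derivatives of the next
    two inequalities vanish at the left end 0. *)
Lemma is_derive_gt0_lt (R : realType) (f f' : R -> R) (a b : R) : a < b ->
  (forall x, a <= x <= b -> is_derive x 1 f (f' x)) ->
  (forall x, a < x < b -> 0 < f' x) -> f a < f b.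
Proof.
move=> ab df f'0; rewrite -subr_gt0.
have [||c cab ->] := @MVT _ f f' a b ab.
- by move=> x; rewrite in_itv/= => /andP[ax xb]; apply: df; rewrite !ltW.
- apply: derivable_within_continuous => x; rewrite in_itv/= => xab.
  by case: (df _ xab).
- by rewrite mulr_gt0 ?subr_gt0// f'0//; move: cab; rewrite in_itv.
Qed.

Lemma is_derive_ge0_le (R : realType) (f f' : R -> R) (a b : R) : a <= b ->
  (forall x, a <= x <= b -> is_derive x 1 f (f' x)) ->
  (forall x, a <= x <= b -> 0 <= f' x) -> f a <= f b.
Proof.
move=> ab df f'0; rewrite -subr_ge0.
have [||c cab ->] := @MVT_segment _ f f' a b ab.
- by move=> x; rewrite in_itv/= => /andP[ax xb]; apply: df; rewrite !ltW.
- apply: derivable_within_continuous => x; rewrite in_itv/= => xab.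
  by case: (df _ xab).
- by rewrite mulr_ge0 ?subr_ge0// f'0//; move: cab; rewrite in_itv.
Qed.

(** * Trigonometric inequalities behind the monotonicity of f *)

Lemma mul_cos_lt_sin (R : realType) (h : R) : 0 < h < pi -> h * cos h < sin h.
Proof.
move=> /andP[h0 hpi]; rewrite -subr_gt0.
have -> : 0 = (sin - id * cos) 0 :> R by rewrite !fctE sin0 mul0r subrr.
apply: (@is_derive_gt0_lt R _ (fun x => x * sin x)) => // x /andP[x0 xh].
- apply: is_derive_eq; rewrite /GRing.scale/=; ring.
- by rewrite mulr_gt0// sin_gt0_pi// x0 (lt_trans xh).
Qed.

(** The difference of the two sides vanishes at 0, and by cos^2 + sin^2 = 1 its derivative is a
    product that [mul_cos_lt_sin] makes positive. It is the numerator of the derivative of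
    [fcoefB]. *)
Lemma sin_mul_cos_lt (R : realType) (h : R) : 0 < h < pi ->
  2 * sin h * cos h < h * (1 + cos h ^+ 2).
Proof.
move=> /andP[h0 hpi]; rewrite -subr_gt0.
pose f : R -> R := id * (cst 1 + cos * cos) - cst 2 * (sin * cos).
suff : f 0 < f h.
  by rewrite /f !fctE sin0 !mul0r mulr0 subrr mulrA expr2.
apply: (@is_derive_gt0_lt R f
  (fun x => sin x * (sin x + 2 * (sin x - x * cos x))));
  [exact: h0| |] => x /andP[x0 xh].
- rewrite /f.
  apply: (is_derive_eq (is_deriveB
    (is_deriveM _ (is_deriveD _ (is_deriveM _ _)))
    (is_deriveM _ (is_deriveM _ _)))).
  rewrite /GRing.scale/= !fctE.
  have := cos2Dsin2 x; set s := sin x; set c := cos x => sc.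
  lra.
- have xpi : 0 < x < pi by rewrite x0 (lt_trans xh).
  have s0 := sin_gt0_pi xpi.
  by rewrite mulr_gt0// addr_gt0// mulr_gt0// subr_gt0 mul_cos_lt_sin.
Qed.

Lemma sin_double (R : realType) (x : R) : sin x = 2 * sin (x / 2) * cos (x / 2).
Proof.
have {1}-> : x = x / 2 *+ 2 by rewrite -mulr_natr divfK.
by rewrite sin_mulr2n; ring.
Qed.

(** * The coefficients A and B of f *)

(** With h = d / 2, f(v, d) = (v + 1) A(h) + 2 sqrt(v) B(h). Both coefficients are written as
    operations on functions, the form on which the derivation rules act. *)
Definition fcoefA (R : realType) : R -> R :=
  (id - sin * cos) * (fun x => (sin x ^+ 2)^-1).
Definition fcoefB (R : realType) : R -> R :=
  (sin - id * cos) * (fun x => (sin x ^+ 2)^-1).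

Lemma is_derive_sin2V (R : realType) (x : R) : sin x != 0 ->
  is_derive x 1 (fun x : R => (sin x ^+ 2)^-1) (- 2 * cos x / sin x ^+ 3).
Proof.
move=> s0; pose g : R -> R := sin ^+ 2.
have := @is_deriveV R g x _ 1 _ _.
move=> /(_ (sin x *+ 2 * cos x)) H.
apply: is_derive_eq.
  apply: H; first by rewrite /g !fctE expf_neq0.
  by apply: is_derive_eq; rewrite /GRing.scale/=; ring.
by rewrite /g !fctE /GRing.scale/=; field.
Qed.

Lemma fcoefA_lt (R : realType) (x y : R) : 0 < x -> x < y -> y < pi ->
  fcoefA R x < fcoefA R y.
Proof.
move=> x0 xy ypi.
apply: (@is_derive_gt0_lt R (fcoefA R)
  (fun x => 2 * (sin x - x * cos x) / sin x ^+ 3)); [exact: xy| |] => z.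
- move=> /andP[xz zy].
  have zpi : 0 < z < pi by rewrite (lt_le_trans x0)// (le_lt_trans zy).
  have s0 : sin z != 0 by rewrite gt_eqF// sin_gt0_pi.
  have := is_derive_sin2V R z s0 => ?.
  apply: is_derive_eq; rewrite /GRing.scale/= !fctE.
  have := cos2Dsin2 z; set s := sin z in s0 *; set c := cos z => sc.
  (* Pythagoras times [s]: the numerators are cubic, and the final comparison is linear in their
     monomials. *)
  have sc1 : s * (c ^+ 2 + s ^+ 2) = s by rewrite sc mulr1.
  transitivity (((1 - (c ^+ 2 - s ^+ 2)) * s - 2 * c * (z - s * c)) / s ^+ 3);
    first by field.
  congr (_ / _); lra.
- move=> /andP[xz zy].
  have zpi : 0 < z < pi by rewrite (lt_trans x0)// (lt_trans zy).
  have s0 := sin_gt0_pi zpi.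
  by rewrite divr_gt0 ?exprn_gt0// mulr_gt0// subr_gt0 mul_cos_lt_sin.
Qed.

Lemma fcoefB_lt (R : realType) (x y : R) : 0 < x -> x < y -> y < pi ->
  fcoefB R x < fcoefB R y.
Proof.
move=> x0 xy ypi.
apply: (@is_derive_gt0_lt R (fcoefB R)
  (fun x => (x * (1 + cos x ^+ 2) - 2 * sin x * cos x) / sin x ^+ 3));
  [exact: xy| |] => z.
- move=> /andP[xz zy].
  have zpi : 0 < z < pi by rewrite (lt_le_trans x0)// (le_lt_trans zy).
  have s0 : sin z != 0 by rewrite gt_eqF// sin_gt0_pi.
  have := is_derive_sin2V R z s0 => ?.
  apply: is_derive_eq; rewrite /GRing.scale/= !fctE.
  have := cos2Dsin2 z; set s := sin z in s0 *; set c := cos z => sc.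
  have sc1 : z * (c ^+ 2 + s ^+ 2) = z by rewrite sc mulr1.
  transitivity ((z * s ^+ 2 - 2 * s * c + 2 * z * c ^+ 2) / s ^+ 3);
    first by field.
  congr (_ / _); lra.
- move=> /andP[xz zy].
  have zpi : 0 < z < pi by rewrite (lt_trans x0)// (lt_trans zy).
  have s0 := sin_gt0_pi zpi.
  by rewrite divr_gt0 ?exprn_gt0// subr_gt0 sin_mul_cos_lt.
Qed.

(** The numerator is positive because 2 sin h cos h < h (1 + cos^2 h) <= 2 h. *)
Lemma fcoefA_gt0 (R : realType) (h : R) : 0 < h < pi -> 0 < fcoefA R h.
Proof.
move=> hpi; have s0 := sin_gt0_pi hpi.
rewrite /fcoefA !fctE divr_gt0 ?exprn_gt0// subr_gt0.
have := sin_mul_cos_lt R h hpi; have := cos2Dsin2 h.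
case/andP: hpi => h0 _; move: (sin h) (cos h) s0 => s c s0 cs1 H.
have c1 : c ^+ 2 <= 1 by rewrite -cs1 lerDl sqr_ge0.
have : h * c ^+ 2 <= h by rewrite -[leRHS]mulr1 ler_wpM2l// ltW.
lra.
Qed.

Lemma fcoefB_gt0 (R : realType) (h : R) : 0 < h < pi -> 0 < fcoefB R h.
Proof.
move=> hpi; have s0 := sin_gt0_pi hpi.
by rewrite /fcoefB !fctE divr_gt0 ?exprn_gt0// subr_gt0 mul_cos_lt_sin.
Qed.

(** * Monotonicity of f, and delta and Gamma as solutions of f(v, d) = x *)

Lemma fHE (R : realType) (v d : R) : 0 < d < 2 * pi ->
  fH v d = (v + 1) * fcoefA R (d / 2) + 2 * Num.sqrt v * fcoefB R (d / 2).
Proof.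
move=> /andP[d0 dpi]; rewrite /fH gt_eqF// /fcoefA /fcoefB !fctE.
have : 0 < sin (d / 2) by apply: sin_gt0_pi; apply/andP; split; lra.
rewrite (sin_double R d).
by move=> /gt_eqF/negbT s0; field.
Qed.

Lemma fHN (R : realType) (v d : R) : fH v (- d) = - fH v d.
Proof.
rewrite /fH oppr_eq0; case: eqP => _; first by rewrite oppr0.
by rewrite mulNr !sinN cosN sqrrN -[RHS]mulNr; congr (_ / _); ring.
Qed.

Lemma fH_gt0 (R : realType) (v d : R) : 0 <= v -> 0 < d < 2 * pi -> 0 < fH v d.
Proof.
move=> v0 dpi; rewrite fHE//.
have hpi : 0 < d / 2 < pi by apply/andP; lra.
rewrite ltr_wpDr//.
  by rewrite mulr_ge0 ?(ltW (fcoefB_gt0 _ _ hpi))// mulr_ge0 ?sqrtr_ge0.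
by rewrite mulr_gt0 ?fcoefA_gt0// ltr_wpDl.
Qed.

(** Strictness comes from the A term, whose factor v + 1 is positive; the B term may vanish, at v =
    0. *)
Lemma fH_lt_angle (R : realType) (v d d' : R) : 0 <= v -> 0 < d -> d < d' ->
  d' < 2 * pi -> fH v d < fH v d'.
Proof.
move=> v0 d0 dd' d'pi.
have ? : d < 2 * pi by rewrite (lt_trans dd').
have ? : 0 < d' by rewrite (lt_trans d0).
rewrite !fHE; do 2?[exact/andP].
rewrite ltr_leD//.
  by rewrite ltr_pM2l ?ltr_wpDl// fcoefA_lt//; lra.
rewrite ler_wpM2l ?mulr_ge0 ?sqrtr_ge0//.
by apply/ltW/fcoefB_lt; lra.
Qed.

Lemma fH_lt_height (R : realType) (v v' d : R) : 0 <= v -> v < v' ->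
  0 < d < 2 * pi -> fH v d < fH v' d.
Proof.
move=> v0 vv' dpi; have hpi : 0 < d / 2 < pi by apply/andP; lra.
rewrite !fHE// ltr_leD//.
  by rewrite ltr_pM2r ?fcoefA_gt0// ltrD2r.
by rewrite ler_pM2r ?fcoefB_gt0// ler_pM2l// ler_sqrt ?ltW// (le_lt_trans v0).
Qed.

(** Turns the choice in [deltaH] into an equation. The solution is unique: f is odd in the angle,
    zero at angle 0, and positive and strictly increasing for positive angles. *)
Lemma deltaH_eq (R : realType) (x v th : R) : 0 <= v -> 0 < th < 2 * pi ->
  deltaH x v = th <-> fH v th = x.
Proof.
move=> v0 /[dup] thpi /andP[th0 th2pi]; split.
  (* If no angle solved the equation, [xget] would return its default 0, but [th] is positive. *)
  rewrite /deltaH; case: xgetP => [d _ [_ fx] <-//|_ /esym th_eq].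
  by rewrite th_eq ltxx in th0.
move=> fx; apply: xget_unique.
  by split=> //; rewrite th2pi andbT (lt_trans _ th0)// oppr_lt0 (lt_trans th0).
move=> d [/andP[dl dr] fd]; have ft0 := fH_gt0 _ v th v0 thpi.
have [d0|d0|d0] := ltgtP d 0.
- have : 0 < fH v (- d) by apply: fH_gt0 => //; rewrite oppr_gt0 d0 ltrNl.
  by rewrite fHN fd -fx oppr_gt0 => /(lt_trans ft0); rewrite ltxx.
- have [dth|thd|//] := ltgtP d th.
    by have := fH_lt_angle _ v d th v0 d0 dth th2pi; rewrite fd fx ltxx.
  by have := fH_lt_angle _ v th d v0 th0 thd dr; rewrite fd fx ltxx.
- by move: ft0; rewrite fx -fd d0 /fH eqxx ltxx.
Qed.

Lemma in_Gamma (R : realType) (x v th : R) : 0 < th < 2 * pi ->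
  (x, v) \in Gamma th <-> 0 <= v /\ fH v th = x.
Proof.
move=> thpi; rewrite inE /Gamma /=; split=> -[v0 H]; split=> //.
  exact/deltaH_eq.
exact/deltaH_eq.
Qed.

Lemma gGamma_fH (R : realType) (v th : R) : 0 <= v -> 0 < th < 2 * pi ->
  gGamma th (fH v th) = v.
Proof.
move=> v0 thpi; apply: xget_unique; first exact/in_Gamma.
move=> u /in_Gamma-/(_ thpi)[u0 fuv].
have [uv|vu|//] := ltgtP u v.
  by have := fH_lt_height _ u v th u0 uv thpi; rewrite fuv ltxx.
by have := fH_lt_height _ v u th v0 vu thpi; rewrite fuv ltxx.
Qed.

(** * The slope of Gamma and its tangent line *)

(** On the graph x = A w^2 + 2 B w + A and v = w^2, so the slope is 2 w / (2 (A w + B)).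
    Differentiability is obtained by solving the quadratic for w near the given point. *)
Lemma is_derive_gGamma (R : realType) (w th : R) : 0 < w -> 0 < th < 2 * pi ->
  is_derive (fH (w ^+ 2) th) 1 (gGamma th)
    (w / (fcoefA R (th / 2) * w + fcoefB R (th / 2))).
Proof.
move=> w0 thpi; have hpi : 0 < th / 2 < pi by apply/andP; lra.
have A0 := fcoefA_gt0 _ _ hpi; have B0 := fcoefB_gt0 _ _ hpi.
have fE u : 0 <= u -> fH (u ^+ 2) th =
    fcoefA R (th / 2) * u ^+ 2 + 2 * fcoefB R (th / 2) * u + fcoefA R (th / 2).
  by move=> u0; rewrite fHE// sqrtr_sqr ger0_norm//; ring.
move: (fcoefA R _) (fcoefB R _) => A B in A0 B0 fE *.
set x0 := fH _ _.
have x0E : x0 = A * w ^+ 2 + 2 * B * w + A by rewrite /x0 fE// ltW.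
(* [D x] is a quarter of the discriminant of A u^2 + 2 B u + A - x, and [W x] is the larger root. *)
pose D x := B ^+ 2 + A * (x - A).
pose W x := (Num.sqrt (D x) - B) / A.
have Ax0 : A < x0 by rewrite x0E ltrDr addr_gt0// !mulr_gt0// exprn_gt0.
have S0 : Num.sqrt (D x0) = A * w + B.
  have -> : D x0 = (A * w + B) ^+ 2 by rewrite /D x0E; ring.
  by rewrite sqrtr_sqr gtr0_norm// addr_gt0// mulr_gt0.
have Wx0 : W x0 = w by rewrite /W S0; field; rewrite gt_eqF.
(* Near [x0] one has x > A, hence D > B^2, so the root is nonnegative and [fE] applies to it. *)
have gW : {near x0, gGamma th =1 (fun x => W x ^+ 2)}.
  near=> x.
  have Ax : A < x by near: x; exact: lt_nbhsr.
  have D0 : B ^+ 2 < D x by rewrite /D ltrDl mulr_gt0// subr_gt0.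
  have D0' : 0 < D x by rewrite (le_lt_trans _ D0)// sqr_ge0.
  have W0 : 0 <= W x.
    rewrite /W divr_ge0 ?ltW// subr_gt0.
    by rewrite -[ltLHS]gtr0_norm// -sqrtr_sqr ltr_sqrt.
  have {1}-> : x = fH (W x ^+ 2) th; last by rewrite gGamma_fH ?sqr_ge0.
  have : A * W x = Num.sqrt (D x) - B by rewrite /W; field; rewrite gt_eqF.
  have : Num.sqrt (D x) ^+ 2 = D x by rewrite sqr_sqrtr// ltW.
  rewrite fE//; move: (W x) (Num.sqrt (D x)) => u r; rewrite /D => rE uE.
  apply: (mulfI (lt0r_neq0 A0)).
  have -> : A * (A * u ^+ 2 + 2 * B * u + A) =
    (A * u) ^+ 2 + 2 * B * (A * u) + A ^+ 2 by ring.
  by rewrite uE; lra.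
have dD : is_derive x0 1 D A.
  have -> : D = cst (B ^+ 2 - A ^+ 2) + A \*: id.
    by apply/funext => x; rewrite /D fctE/= /GRing.scale/=; ring.
  by apply: is_derive_eq; rewrite add0r /GRing.scale/= mulr1.
have D0 : 0 < D x0 by rewrite /D ltr_wpDl ?sqr_ge0// mulr_gt0// subr_gt0.
have dW : is_derive x0 1 W (2 * (A * w + B))^-1.
  have -> : W = A^-1 \*: ((Num.sqrt \o D) - cst B).
    by apply/funext => x; rewrite /W mulrC.
  have dS := @is_derive1_sqrt R _ D0.
  apply: is_derive_eq; rewrite /GRing.scale/= S0 subr0; field.
  by rewrite !gt_eqF// addr_gt0// mulr_gt0.
apply: (@near_eq_is_derive _ _ _ (fun x => W x ^+ 2)).
  by move: gW; apply: filterS => x ->.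
apply: (is_derive_eq (is_deriveX 2 dW)).
rewrite Wx0 /GRing.scale/= expr1; field.
by rewrite gt_eqF// addr_gt0// mulr_gt0.
Unshelve. all: by end_near.
Qed.

Lemma half_angle_gt0 (R : realType) (th : R) : 0 < th < pi ->
  0 < sin (th / 2) /\ 0 < cos (th / 2).
Proof.
move=> /andP[th0 thpi]; split.
  by apply: sin_gt0_pihalf; apply/andP; lra.
by apply: cos_gt0_pihalf; have := pi_gt0 R => pi0; apply/andP; lra.
Qed.

Lemma fH_Ptheta (R : realType) (th : R) : 0 < th < pi ->
  fH (Ptheta th).2 th = (Ptheta th).1.
Proof.
move=> thpi; have [s0 c0] := half_angle_gt0 R th thpi.
rewrite fHE; last by have := pi_gt0 R; case/andP: thpi => *; apply/andP; lra.
rewrite /Ptheta/= sqrtr_sqr gtr0_norm// /fcoefA /fcoefB !fctE (sin_double R th).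
have := cos2Dsin2 (th / 2).
move: (sin _) (cos _) s0 c0 => s c s0 c0 cs1.
have -> : c ^+ 2 = 1 - s ^+ 2 by rewrite -cs1 addrK.
have {cs1}c2 : c * c = 1 - s ^+ 2 by rewrite -expr2 -cs1 addrK.
(* The last term of the numerator vanishes by Pythagoras; isolating it leaves two rational
   identities. *)
transitivity ((th * s ^+ 2 / 2 + s * c * s ^+ 2 -
  th * (c * c - 1 + s ^+ 2)) / s ^+ 2).
  by field; rewrite gt_eqF.
by rewrite c2; field; rewrite gt_eqF.
Qed.

Lemma Ptheta_in_Gamma (R : realType) (th : R) : 0 < th < pi ->
  Ptheta th \in Gamma th.
Proof.
move=> thpi; apply/in_Gamma.
  by have := pi_gt0 R; case/andP: thpi => *; apply/andP; lra.
by split; [exact: sqr_ge0|exact: fH_Ptheta].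
Qed.

Lemma TthetaE (R : realType) (th : R) : 0 < th < pi ->
  Ttheta th = [set p : R * R | p.1 = th / 2 + p.2 * tan (th / 2)].
Proof.
move=> thpi; have [s0 c0] := half_angle_gt0 R th thpi.
have th2pi : 0 < th < 2 * pi.
  by have := pi_gt0 R; case/andP: thpi => *; apply/andP; lra.
have gE : gGamma th (Ptheta th).1 = cos (th / 2) ^+ 2.
  by rewrite -fH_Ptheta// gGamma_fH// sqr_ge0.
(* At w = cos (th / 2) the terms of A w + B that carry [th] cancel, leaving sin (th / 2). *)
have dgE : derive1 (gGamma th) (Ptheta th).1 = cos (th / 2) / sin (th / 2).
  have /@derive_val := is_derive_gGamma R _ _ c0 th2pi.
  rewrite -[_ ^+ 2]/(Ptheta th).2 fH_Ptheta// derive1E => ->.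
  congr (_ / _); rewrite /fcoefA /fcoefB !fctE.
  have := cos2Dsin2 (th / 2); move: (sin _) (cos _) s0 => s c s0 cs1.
  transitivity (s * (1 - c ^+ 2) / s ^+ 2); first by field; rewrite gt_eqF.
  by rewrite -cs1 addrAC subrr add0r mulfK// expf_neq0// gt_eqF.
apply/seteqP; split=> -[x v];
  rewrite /Ttheta/= -/(Ptheta th).1 gE dgE /tan /Ptheta/= (sin_double R th);
  move: (sin _) (cos _) s0 c0 {gE dgE} => s c s0 c0 ->; field;
  by rewrite !gt_eqF.
Qed.

(** * Lower bound: integration and the calibration along a curve *)

(** The integral of a nonnegative function is a supremum over simple functions below it, and a
    larger integrand has more of these. This compares a continuous speed with [speedH] of an
    arbitrary curve without a study of measurability. *)
Lemma ge0_le_integral_nonmeasurable d (T : measurableType d) (R : realType)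
    (mu : {measure set T -> \bar R}) (D : set T) (f g : T -> \bar R) :
  (forall x, D x -> (0 <= f x)%E) -> (forall x, D x -> (f x <= g x)%E) ->
  (\int[mu]_(x in D) f x <= \int[mu]_(x in D) g x)%E.
Proof.
move=> f0 fg; rewrite !ge0_integralE//; last first.
  by move=> x Dx; rewrite (le_trans (f0 _ Dx))// fg.
apply: ereal_sup_le => _ [h hf <-]; exists h => // x.
by rewrite (le_trans (hf x))// lee_restrict.
Qed.

Lemma continuous_antiderivative (R : realType) (f : R -> R) (a b : R) :
  continuous f ->
  exists F : R -> R, forall x, a <= x <= b -> is_derive x 1 F (f x).
Proof.
move=> cf; exists (fun x => (\int[lebesgue_measure]_(t in `[a - 1, x]) f t)%R).
move=> x /andP[ax xb].
have [| |//||dF F'E] := @continuous_FTC1_closed R f (a - 1) x (x + 1).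
- by rewrite ltrDl.
- apply: continuous_compact_integrable; first exact: segment_compact.
  exact: continuous_subspaceT.
- by rewrite (lt_le_trans _ ax)// ltrBlDr ltrDl.
- exact: cf.
- by apply: DeriveDef; [exact: dF|rewrite -derive1E; exact: F'E].
Qed.

(* Cauchy-Schwarz on [x' - v' T], then AM-GM on [1] and [V (1 + T^2)] *)
Lemma calibration_ineq (R : realType) (x' v' s V T : R) : 0 < V -> 0 <= s ->
  s ^+ 2 * V = x' ^+ 2 + v' ^+ 2 ->
  x' - v' * T <= s / 2 * (1 + V * (1 + T ^+ 2)).
Proof.
move=> V0 s0 sE; set q := 1 + T ^+ 2.
have q0 : 0 < q by rewrite ltr_wpDr ?sqr_ge0.
have rhs0 : 0 <= s / 2 * (1 + V * q).
  by rewrite mulr_ge0 ?divr_ge0// addr_ge0// mulr_ge0// ltW.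
rewrite (le_trans (ler_norm _))// -(ger0_norm rhs0) -ler_sqr ?nnegrE//.
rewrite !real_normK ?num_real//.
have cs : (x' - v' * T) ^+ 2 <= s ^+ 2 * V * q.
  rewrite sE /q -subr_ge0.
  rewrite [leRHS](_ : _ = (x' * T + v') ^+ 2); first exact: sqr_ge0.
  by ring.
apply: (le_trans cs); rewrite -subr_ge0.
rewrite [leRHS](_ : _ = (s / 2 * (1 - V * q)) ^+ 2); first exact: sqr_ge0.
by field.
Qed.

(** Here [s] is the speed and [G] the arc length. As [G] is nondecreasing from 0 to less than pi, G
    / 2 stays in [0, pi / 2), where tan is differentiable, and [calibration_ineq] says that the
    derivative of the followed quantity is nonnegative. *)
Lemma barrier_le (R : realType) (x v x' v' s G : R -> R) :
  (forall t : R, 0 <= t <= 1 -> is_derive t 1 x (x' t)) ->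
  (forall t : R, 0 <= t <= 1 -> is_derive t 1 v (v' t)) ->
  (forall t : R, 0 <= t <= 1 -> is_derive t 1 G (s t)) ->
  (forall t : R, 0 <= t <= 1 -> 0 < v t) ->
  (forall t : R, 0 <= t <= 1 -> 0 <= s t) ->
  (forall t : R, 0 <= t <= 1 -> s t ^+ 2 * v t = x' t ^+ 2 + v' t ^+ 2) ->
  x 0 = 0 -> G 0 = 0 -> G 1 < pi ->
  x 1 <= G 1 / 2 + v 1 * tan (G 1 / 2).
Proof.
move=> dx dv dG v0 s0 sE x0 G0 G1.
have cosG (t : R) : 0 <= t <= 1 -> 0 < cos (G t / 2).
  move=> /andP[t0 t1].
  have Gt0 : 0 <= G t.
    rewrite -G0; apply: (@is_derive_ge0_le R G s) => // u /andP[u0 ut];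
      by [apply: dG; rewrite u0 (le_trans ut)|
          apply: s0; rewrite u0 (le_trans ut)].
  have Gt1 : G t <= G 1.
    apply: (@is_derive_ge0_le R G s) => // u /andP[tu u1];
      by [apply: dG; rewrite u1 (le_trans t0)|
          apply: s0; rewrite u1 (le_trans t0)].
  by apply: cos_gt0_pihalf; have := pi_gt0 R => pi0; apply/andP; lra.
pose T t := tan (G t / 2).
pose E : R -> R := 2^-1 \*: G + v * (tan \o (2^-1 \*: G)) - x.
have EE t : E t = G t / 2 + v t * T t - x t.
  by rewrite /E !fctE/= /GRing.scale/= ![_ * G t]mulrC.
rewrite -subr_ge0 -EE.
have <- : E 0 = 0 by rewrite EE x0 G0 /T G0 mul0r tan0 mulr0 !addr0 subr0.
pose E' t := s t / 2 * (1 + v t * (1 + T t ^+ 2)) - (x' t - v' t * T t).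
have dE (t : R) : 0 <= t <= 1 -> is_derive t 1 E (E' t).
  move=> t01; have c0 := cosG t t01.
  have dxt := dx t t01; have dvt := dv t t01; have dGt := dG t t01.
  have G2 : (2^-1 \*: G) t = G t / 2 by rewrite /= /GRing.scale/= mulrC.
  have dT : is_derive ((2^-1 \*: G) t) 1 tan (1 + T t ^+ 2).
    by rewrite G2 -cos2_tan2 ?gt_eqF//; apply: is_derive_tan; rewrite gt_eqF.
  apply: (is_derive_eq (is_deriveB (is_deriveD (is_deriveZ _ dGt)
    (is_deriveM dvt (is_derive1_comp dT (is_deriveZ _ dGt)))) dxt)).
  by rewrite fctE G2 -/(T t) /GRing.scale/= /E'; field.
apply: (is_derive_ge0_le R E E' 0 1 ler01 dE) => t t01; rewrite subr_ge0.
exact: (calibration_ineq R _ _ _ _ _ (v0 t t01) (s0 t t01) (sE t t01)).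
Qed.

Lemma tan_le (R : realType) (x y : R) :
  - (pi / 2) < x -> x <= y -> y < pi / 2 -> tan x <= tan y.
Proof.
move=> x0; rewrite le_eqVlt => /predU1P[->//|xy] ypi.
rewrite ltW// ltr_tan// in_itv/= ?x0 ?ypi ?andbT ?(lt_trans x0)//.
by rewrite (lt_trans xy).
Qed.

(** If the length l were below [th], the barrier for slightly raised curves would give in the limit
    p.1 <= l / 2 + p.2 tan (l / 2), which is strictly less than th / 2 + p.2 tan (th / 2) = p.1. *)
Lemma lengthH_ge (R : realType) (c : R -> R * R) (p : R * R) (th : R) :
  0 < th < pi -> admissible_curve c (0, 1) p ->
  p.1 = th / 2 + p.2 * tan (th / 2) -> (th%:E <= lengthH c)%E.
Proof.
move=> /andP[th0 thpi] [dx [dv [cx' [cv' [v0 [c0 c1]]]]]] pT.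
set x := fun s => (c s).1 in dx cx'; set v := fun s => (c s).2 in dv cv'.
rewrite leNgt; apply/negP => len_lt.
have len0 : (0 <= lengthH c)%E.
  apply: integral_ge0 => t _; rewrite /speedH; case: ifP => _.
    by rewrite lee_fin sqrtr_ge0.
  by case: ifP => _ //; exact: leey.
have [l lenE] : exists l, lengthH c = l%:E.
  exists (fine (lengthH c)); rewrite fineK// ge0_fin_numE//.
  by rewrite (lt_trans len_lt)// ltry.
move: len_lt len0; rewrite lenE lte_fin lee_fin => lth l0.
have cv : continuous v.
  by move=> t; exact/differentiable_continuous/derivable1_diffP/dv.
have key e : 0 < e -> p.1 <= l / 2 + (p.2 + e) * tan (l / 2).
  move=> e0.
  (* Raising the curve by [e] only shortens it and keeps it off the boundary;
     [max] matters only outside [0, 1], where [v] may be negative. *)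
  pose V t := Num.max (v t) 0 + e.
  have V0 t : 0 < V t by rewrite ltr_wpDl// le_max lexx orbT.
  pose s t := Num.sqrt ((derive1 x t ^+ 2 + derive1 v t ^+ 2) / V t).
  have cs : continuous s.
    move=> t; apply: continuous_comp; last exact: sqrt_continuous.
    apply: continuousM.
      apply: (@continuousD _ _ _ (fun t => derive1 x t ^+ 2)
          (fun t => derive1 v t ^+ 2)); apply: continuousM;
        [exact: cx'|exact: cx'|exact: cv'|exact: cv'].
    apply: continuousV; first by rewrite gt_eqF.
    apply: continuousD; last exact: cst_continuous.
    by apply: continuous_max; [exact: cv|exact: cst_continuous].
  have [F dF] := @continuous_antiderivative R s 0 1 cs.
  have FE : ((F 1 - F 0)%:E <= lengthH c)%E.
    have <- : (\int[lebesgue_measure]_(t in `[0%R, 1%R]) (s t)%:E =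
              (F 1 - F 0)%:E)%E.
      apply: continuous_FTC2 => //.
      - exact: continuous_subspaceT.
      - split.
        + move=> t; rewrite in_itv/= => /andP[t0 t1].
          by have [] := dF t; first by rewrite !ltW.
        + apply: cvg_at_right_filter.
          apply: (@is_derive_continuous _ _ _ (s 0)).
          by apply: dF; rewrite lexx ler01.
        + apply: cvg_at_left_filter.
          apply: (@is_derive_continuous _ _ _ (s 1)).
          by apply: dF; rewrite lexx ler01.
      - move=> t; rewrite in_itv/= => /andP[t0 t1].
        rewrite derive1E; apply: derive_val.
        by apply: dF; rewrite !ltW.
    apply: ge0_le_integral_nonmeasurable => t; rewrite /= in_itv/= => t01.
      by rewrite lee_fin sqrtr_ge0.
    rewrite /speedH -/x -/v -/(v t); set sq := _ + _.
    have sq0 : 0 <= sq by rewrite addr_ge0// sqr_ge0.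
    case: ifPn => [vt0|_].
      rewrite lee_fin ler_wsqrtr// ler_wpM2l// lef_pV2 ?posrE//.
      by rewrite /V max_l ?lerDl ltW.
    (* On the boundary the curve is either at rest, and then the raised speed is 0 too, or [speedH]
       is infinite. *)
    case: ifPn => [/eqP sqE|_]; last exact: leey.
    by rewrite /s -/sq sqE mul0r sqrtr0.
  move: FE; rewrite lenE lee_fin => Fl.
  have := @barrier_le R x (v + cst e) (derive1 x) (derive1 v) s (F - cst (F 0)).
  have addE (f : R -> R) (k t : R) : (f + cst k) t = f t + k by [].
  have subE (f : R -> R) (k t : R) : (f - cst k) t = f t - k by [].
  rewrite !addE !subE subrr.
  have vt t : 0 <= t <= 1 -> v t + e = V t.
    by move=> t01; rewrite /V max_l//; exact: v0.
  move=> H.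
  have {}H :
      x 1 <= (F 1 - F 0) / 2 + (v 1 + e) * tan ((F 1 - F 0) / 2).
    apply: H => //.
    - by move=> t _; rewrite derive1E; exact: derivableP.
    - move=> t _; rewrite derive1E.
      apply: (is_derive_eq
        (is_deriveD (derivableP (dv t)) (is_derive_cst _ _ _))).
      by rewrite addr0.
    - move=> t t01.
      apply: (is_derive_eq (is_deriveB (dF t t01) (is_derive_cst _ _ _))).
      by rewrite subr0.
    - by move=> t t01; rewrite addE vt.
    - by move=> t _; exact: sqrtr_ge0.
    - move=> t t01; rewrite addE vt// sqr_sqrtr ?divfK ?gt_eqF//.
      by apply: divr_ge0; [rewrite addr_ge0 ?sqr_ge0|exact/ltW].
    - by rewrite /x c0.
    - by rewrite (le_lt_trans Fl)// (lt_trans lth).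
  have p20 : 0 <= v 1 by apply: v0; rewrite lexx ler01.
  have g0 : 0 <= F 1 - F 0.
    rewrite subr_ge0; apply: (is_derive_ge0_le R F s 0 1 ler01 dF) => t _.
    exact: sqrtr_ge0.
  move: H p20; rewrite /x /v c1 => H p20; apply: (le_trans H).
  (* The bound increases with the arc length, so F 1 - F 0 may be replaced by [l]. *)
  rewrite lerD ?ler_pM2r// ler_wpM2l ?addr_ge0 ?(ltW e0)//.
  apply: tan_le; lra.
have T0 : 0 <= tan (l / 2).
  by rewrite -(@tan0 R); apply: tan_le; have := pi_gt0 R; lra.
have p20 : 0 <= p.2 by rewrite -c1; apply: v0; rewrite lexx ler01.
have : p.1 <= l / 2 + p.2 * tan (l / 2).
  apply/ler_addgt0Pr => e e0.
  have T1 : 0 < tan (l / 2) + 1 by rewrite ltr_wpDl.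
  (* With this height the error is e tan / (tan + 1) <= e; the added 1 keeps the denominator
     positive when l = 0. *)
  apply: (le_trans (key (e / (tan (l / 2) + 1)) _)); first exact: divr_gt0.
  rewrite mulrDl addrA lerD2l mulrAC ler_pdivrMr// ler_pM2l// lerDl.
  exact: ler01.
rewrite pT leNgt => /negP; apply.
by rewrite ltr_leD ?ltr_pM2r// ler_wpM2l// tan_le//; lra.
Qed.

(** * Upper bound: the cycloid from (0, 1) to the point of tangency *)

Definition cycloid (R : realType) (th t : R) : R * R :=
  ((th * t + sin (th * t)) / 2, (1 + cos (th * t)) / 2).

Lemma is_derive_cycloid1 (R : realType) (th t : R) :
  is_derive t 1 (fun s => (cycloid R th s).1) (th * (1 + cos (th * t)) / 2).
Proof.
have -> : (fun s => (cycloid R th s).1) =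
    2^-1 \*: (th \*: id + (sin \o (th \*: id))).
  by apply/funext => s; rewrite /cycloid fctE/= /GRing.scale/= mulrC.
by apply: is_derive_eq; rewrite /= /GRing.scale/=; field.
Qed.

Lemma is_derive_cycloid2 (R : realType) (th t : R) :
  is_derive t 1 (fun s => (cycloid R th s).2) (- (th * sin (th * t)) / 2).
Proof.
have -> : (fun s => (cycloid R th s).2) =
    2^-1 \*: (cst 1 + (cos \o (th \*: id))).
  by apply/funext => s; rewrite /cycloid fctE/= /GRing.scale/= mulrC.
by apply: is_derive_eq; rewrite /= /GRing.scale/=; field.
Qed.

Lemma derive1_cycloid (R : realType) (th : R) :
  derive1 (fun s => (cycloid R th s).1) =
    (fun t => th * (1 + cos (th * t)) / 2) /\
  derive1 (fun s => (cycloid R th s).2) = (fun t => - (th * sin (th * t)) / 2).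
Proof.
split; apply/funext => t; rewrite derive1E; apply: derive_val.
  exact: is_derive_cycloid1.
exact: is_derive_cycloid2.
Qed.

Lemma cycloid_admissible (R : realType) (th : R) :
  admissible_curve (cycloid R th) (0, 1) (Ptheta th).
Proof.
have [d1 d2] := derive1_cycloid R th.
have cth (t : R) : {for t, continuous (fun s : R => th * s)}.
  exact: mulrl_continuous.
split; first by move=> t; have [] := is_derive_cycloid1 R th t.
split; first by move=> t; have [] := is_derive_cycloid2 R th t.
split.
  rewrite d1 => t /=; apply: cvgM; last exact: cvg_cst.
  apply: cvgM; first exact: cvg_cst.
  apply: cvgD; first exact: cvg_cst.
  by apply: continuous_comp; [exact: cth|exact: continuous_cos].
split.
  rewrite d2 => t /=; apply: cvgM; last exact: cvg_cst.
  apply: cvgN; apply: cvgM; first exact: cvg_cst.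
  by apply: continuous_comp; [exact: cth|exact: continuous_sin].
split.
  move=> t _ /=; rewrite divr_ge0// -lerBlDl sub0r; exact: cos_geN1.
rewrite /cycloid /Ptheta !mulr0 mulr1 sin0 cos0; split.
  by congr pair; field.
congr pair.
have {1}-> : th = th / 2 *+ 2 by rewrite -mulr_natr divfK.
by rewrite cos_mulr2n; field.
Qed.

(** With c and s the cosine and sine of th t / 2, the velocity is (th c^2, - th s c) and the height
    is c^2, so the speed is [th]. The bound th < pi keeps c positive and the curve off the
    boundary. *)
Lemma lengthH_cycloid (R : realType) (th : R) : 0 < th < pi ->
  lengthH (cycloid R th) = th%:E.
Proof.
move=> /andP[th0 thpi].
rewrite /lengthH (eq_integral (cst th%:E)).
  rewrite integral_cst//=. rewrite lebesgue_measure_itv/= lte_fin ltr01.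
  by rewrite -EFinB subr0 mule1.
move=> t; rewrite inE/= in_itv/= => /andP[t0 t1].
have c2 : 0 < cos (th * t / 2).
  have tht0 : 0 <= th * t by rewrite mulr_ge0// ltW.
  have tht1 : th * t <= th by rewrite ler_piMr// ltW.
  by apply: cos_gt0_pihalf; have := pi_gt0 R => pi0; apply/andP; lra.
have cE : cos (th * t) = 2 * cos (th * t / 2) ^+ 2 - 1.
  have {1}-> : th * t = th * t / 2 *+ 2 by rewrite -mulr_natr divfK.
  by rewrite cos_mulr2n; ring.
have vE : (cycloid R th t).2 = cos (th * t / 2) ^+ 2 by rewrite /= cE; field.
have [d1 d2] := derive1_cycloid R th.
rewrite /speedH d1 d2 vE exprn_gt0// (sin_double R (th * t)) cE; congr EFin.
rewrite -[RHS](ger0_norm (ltW th0)) -sqrtr_sqr; congr Num.sqrt.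
have := cos2Dsin2 (th * t / 2).
move: (sin _) (cos _) c2 => s c c2 cs1.
transitivity (th ^+ 2 * (c ^+ 2 + s ^+ 2)); first by field; rewrite gt_eqF.
by rewrite cs1 mulr1.
Qed.

Theorem theorem5p1 (R : realType) (th : R) :
  0 < th < pi ->
  Ptheta th \in Gamma th /\
  ereal_inf [set dH (0, 1) P | P in Ttheta th `&` @Hplane R] = th%:E /\
  Ttheta th = [set p : R * R | p.1 = th / 2 + p.2 * tan (th / 2)] /\
  Ttheta th `&` @Hplane R = Lline (th / 2) (tan (th / 2)).
Proof.
move=> thpi; split; first exact: Ptheta_in_Gamma.
split; last first.
  split; first exact: TthetaE.
  rewrite TthetaE//; apply/seteqP.
  by split=> -[x v]; rewrite /Lline /Hplane/= [v * _]mulrC => -[].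
rewrite TthetaE//; apply/eqP; rewrite eq_le; apply/andP; split.
  (* Upper bound: the point of tangency lies on the line, and the cycloid reaches it with length
     [th]. *)
  apply: ge_ereal_inf; exists (dH (0, 1) (Ptheta th)).
    exists (Ptheta th) => //; split; last exact: sqr_ge0.
    have [s0 c0] := half_angle_gt0 R th thpi.
    rewrite /Ptheta/= (sin_double R th) /tan; field.
    by rewrite gt_eqF.
  rewrite -(lengthH_cycloid R th thpi); apply: ereal_inf_lbound.
  by exists (cycloid R th) => //; exact: cycloid_admissible.
(* Lower bound: every admissible curve from (0, 1) to any point of the line has length at least
   [th]. *)
apply: le_ereal_inf_tmp => _ [P [PT _] <-].
apply: le_ereal_inf_tmp => _ [c cP <-].
exact: lengthH_ge cP PT.
Qed.
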